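(* Consider the matrix Riccati equation $\dot P=-PA(t)-A(t)^{T}P+PS(t)P-Q(t)$, $P(t_f)=0$, on $[t_0,t_f]$, integrated backward in time, with $A:[t_0,t_f]\to\mathbb{R}^{n\times n}$ continuous and $S,Q:[t_0,t_f]\to\mathbb{R}^{n\times n}$ Lipschitz continuous with symmetric positive definite values, and let $$M(t)=\begin{bmatrix}-A(t)^{T}&-Q(t)\\ -S(t)&A(t)\end{bmatrix}.$$ 1. The commutator-free Magnus integrator based on fourth-order Gaussian quadrature, $$\Psi_h(t)=\exp\big(h(\alpha M_1+\beta M_2)\big)\exp\big(h(\beta M_1+\alpha M_2)\big),\qquad M_i=M(t+c_ih),$$ with $c_1=\tfrac12-\tfrac{\sqrt3}{6}$, $c_2=\tfrac12+\tfrac{\sqrt3}{6}$, $\alpha=\tfrac14-\tfrac{\sqrt3}{6}$, $\beta=\tfrac14+\tfrac{\sqrt3}{6}$, is conditionally, but not unconditionally, positivity preserving. 2. The commutator-free Magnus integrator based on the Simpson rule, $$\Psi_h(t)=\exp\Big(\tfrac{h}{12}(-M_1+4M_2+3M_3)\Big)\exp\Big(\tfrac{h}{12}(3M_1+4M_2-M_3)\Big),$$ with $M_1=M(t)$, $M_2=M(t+h/2)$, $M_3=M(t+h)$, is not unconditionally positivity preserving.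
   Context: Given $N\ge1$, $h=(t_f-t_0)/N$ and $t_j=t_0+jh$, the integrator is applied backward in time by $$\begin{bmatrix}V_j\\ W_j\end{bmatrix}=\Psi_h(t_j)^{-1}\begin{bmatrix}V_{j+1}\\ W_{j+1}\end{bmatrix},\quad j=N-1,\dots,0,\qquad \begin{bmatrix}V_N\\ W_N\end{bmatrix}=\begin{bmatrix}0\\ I\end{bmatrix},$$ and $\tilde P_j=V_jW_j^{-1}$ is the approximation of $P(t_j)$. The integrator preserves positivity for given data $(A,S,Q)$ and step $h$ if, for all $0\le j\le N-1$, $W_j$ is invertible and $\tilde P_j$ is symmetric positive definite. It is unconditionally positivity preserving if it preserves positivity for all data as in the claim and all step sizes $h>0$. It is conditionally positivity preserving if for all data as in the claim there exists $h^*>0$ (depending on the data) such that it preserves positivity for all step sizes $0<h<h^*$. *)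

(* Defs.v *)
From HB Require Import structures.
From mathcomp Require Import all_boot all_order all_algebra.
From mathcomp Require Import all_classical all_reals all_analysis.

Set Implicit Arguments.
Unset Strict Implicit.
Unset Printing Implicit Defensive.

Import Order.TTheory GRing.Theory Num.Theory.
Import numFieldNormedType.Exports.

Local Open Scope classical_set_scope.
Local Open Scope ring_scope.

Section Matrices.
Context {R : realType} {n : nat}.

(* The limit is taken in the sup-norm topology of 'M[R]_n. *)
Definition expmx (X : 'M[R]_n) : 'M[R]_n :=
  limn (series (fun k => (k`!%:R)^-1 *: X ^+ k)).

Definition sym_posdef (X : 'M[R]_n) : Prop :=
  X^T = X /\ forall v : 'cV[R]_n, v != 0 -> 0 < (v^T *m X *m v) 0 0.

End Matrices.

Section Riccati.
Context {R : realType} {n : nat}.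
Implicit Types (t tf h : R) (A S Q : R -> 'M[R]_n).

(* Coefficients of the Riccati equation
     P' = - P A - A^T P + P S P - Q,   P(tf) = 0,   on [t0, tf].
   They are total functions, but nothing is assumed outside [t0, tf], and the
   integrators below only evaluate them inside [t0, tf]. *)
Record riccati_data t0 tf A S Q : Prop := RiccatiData {
  riccati_A_continuous : {within `[t0, tf], continuous A};
  riccati_S_lipschitz : [lipschitz S t | t in `[t0, tf]];
  riccati_Q_lipschitz : [lipschitz Q t | t in `[t0, tf]];
  riccati_S_posdef : forall t, t0 <= t <= tf -> sym_posdef (S t);
  riccati_Q_posdef : forall t, t0 <= t <= tf -> sym_posdef (Q t) }.

Definition riccati_mx A S Q t : 'M[R]_(n + n) :=
  block_mx (- (A t)^T) (- Q t) (- S t) (A t).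

(* An integrator maps the coefficient M, the step h and the time t to
   Psi_h(t). *)
Definition integrator := (R -> 'M[R]_(n + n)) -> R -> R -> 'M[R]_(n + n).

Implicit Type Psi : integrator.

Definition step_size t0 tf (N : nat) : R := (tf - t0) / N%:R.

(* [backward_state Psi M t0 h N k] is the block column [V_j; W_j] for
   j = N - k, i.e. after k steps backward from t_N; it is meant for k <= N. *)
Fixpoint backward_state Psi (M : R -> 'M[R]_(n + n)) t0 h (N k : nat) :
    'M[R]_(n + n, n) :=
  if k is k'.+1 then
    invmx (Psi M h (t0 + (N - k)%:R * h)) *m backward_state Psi M t0 h N k'
  else col_mx 0 1%:M.

Definition approxV Psi M t0 h (N j : nat) : 'M[R]_n :=
  usubmx (backward_state Psi M t0 h N (N - j)).

Definition approxW Psi M t0 h (N j : nat) : 'M[R]_n :=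
  dsubmx (backward_state Psi M t0 h N (N - j)).

Definition approxP Psi M t0 h (N j : nat) : 'M[R]_n :=
  approxV Psi M t0 h N j *m invmx (approxW Psi M t0 h N j).

Definition preserves_positivity Psi t0 tf A S Q (N : nat) : Prop :=
  let M := riccati_mx A S Q in
  let h := step_size t0 tf N in
  forall j : nat, (j < N)%N ->
    approxW Psi M t0 h N j \in unitmx /\ sym_posdef (approxP Psi M t0 h N j).

(* The admissible step sizes are the h = (tf - t0) / N with N >= 1. *)
Definition unconditionally_positivity_preserving Psi t0 tf : Prop :=
  forall A S Q, riccati_data t0 tf A S Q ->
  forall N : nat, (0 < N)%N -> preserves_positivity Psi t0 tf A S Q N.

Definition conditionally_positivity_preserving Psi t0 tf : Prop :=
  forall A S Q, riccati_data t0 tf A S Q ->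
  exists2 hstar : R, 0 < hstar &
    forall N : nat, (0 < N)%N -> 0 < step_size t0 tf N < hstar ->
      preserves_positivity Psi t0 tf A S Q N.

Definition cfm_gauss : integrator := fun M h t =>
  let c1 := 1 / 2 - Num.sqrt 3 / 6 in
  let c2 := 1 / 2 + Num.sqrt 3 / 6 in
  let alpha := 1 / 4 - Num.sqrt 3 / 6 in
  let beta := 1 / 4 + Num.sqrt 3 / 6 in
  let M1 := M (t + c1 * h) in
  let M2 := M (t + c2 * h) in
  expmx (h *: (alpha *: M1 + beta *: M2)) *m
  expmx (h *: (beta *: M1 + alpha *: M2)).

Definition cfm_simpson : integrator := fun M h t =>
  let M1 := M t in
  let M2 := M (t + h / 2) in
  let M3 := M (t + h) in
  expmx ((h / 12) *: (- M1 + 4 *: M2 + 3 *: M3)) *m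
  expmx ((h / 12) *: (3 *: M1 + 4 *: M2 - M3)).

End Riccati.

Arguments integrator : clear implicits.
Arguments cfm_gauss : clear implicits.
Arguments cfm_simpson : clear implicits.

(* Main.v *)
Require Import Defs.
From mathcomp Require Import all_boot all_order all_algebra.
From mathcomp Require Import all_classical all_reals all_analysis.
From mathcomp Require Import ring lra.

Set Implicit Arguments.
Unset Strict Implicit.
Unset Printing Implicit Defensive.

Import Order.TTheory GRing.Theory Num.Theory.
Import numFieldNormedType.Exports.

Local Open Scope classical_set_scope.
Local Open Scope ring_scope.

(** When W is invertible, V W^-1 is congruent to the transpose of V^T W, so
positivity of the approximation is a statement about the quadratic form
[V; W] |-> V^T W ([posdef_stateP]), and no Riccati flow is needed.

Conditional positivity. The inverse of a step is a product of exponentials of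
matrices X = [a^T, q; s, -a].  Along x' = X x the form changes at the rate
V^T s V + W^T q W, while its skew part, the symplectic form, is constant.
Hence, if q and s are positive definite, exp X makes the form strictly larger
([expmx_hamiltonian_posdef]); since the terminal state [0; I] has form 0, every
later state has a positive definite one.  For the Gauss integrator q and s are
h times combinations such as alpha S(x) + beta S(y) with alpha + beta = 1/2 and
|x - y| <= h.  As S is Lipschitz and uniformly positive on the compact interval
([lipschitz_posdef_bound]), these are positive definite for small h, uniformly
in time ([lipschitz_posdef_comb]), even though alpha < 0.

Failure for large steps. Take N = 1, h = tf - t0, A = 0, Q constant and S a
positive quadratic polynomial in time, all scalar matrices.  Both integrators
have a negative weight, and for a quadratic S they produce the same
combinations, which can be tuned so that the exponential applied first is
exp [0, pi/2; 31 pi/2, 0] and the second is exp ((pi/2) J) with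
J = [0, I; -I, 0].  The first yields a positive definite form.  The second is a
quarter turn, [V; W] |-> [W; -V], which negates it
([state_form_quarter_turn]). *)

(** * Convergence and differentiation of the matrix exponential *)

Lemma cvg_mx (R : realType) (m n : nat) (T : Type) (F : set_system T)
    (f : T -> 'M[R]_(m, n)) (L : 'M[R]_(m, n)) : Filter F ->
  (forall i j, (fun t => f t i j) @ F --> L i j) -> f @ F --> L.
Proof.
move=> FF fL A [P LP PA].
apply: (@filterS _ F _ [set t | forall i j, P i j (f t i j)]).
  by move=> t Pt; apply: PA.
apply: filter_forall => i; apply: filter_forall => j.
exact: (fL i j _ (LP i j)).
Qed.

Section EntrySeries.
Variables (R : realType) (n : nat).
Implicit Types (X Y : 'M[R]_n) (i j : 'I_n) (t : R) (m k : nat).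

(** Coefficients of the power series in t whose sum is the (i, j) entry of
    X^m exp (t X), the m-th derivative of exp (t X). *)
Definition expmx_coef X i j m k : R := (k`!%:R)^-1 * (X ^+ (k + m)) i j.

(** The entries of the powers of X grow at most geometrically. *)
Lemma entry_expr_le X :
  exists2 c : R, 0 <= c & forall k i j, `|(X ^+ k) i j| <= c ^+ k.
Proof.
exists (\sum_i \sum_l `|X i l|).
  by apply: sumr_ge0 => i _; apply: sumr_ge0.
elim=> [|k IHk] i j.
  by rewrite !expr0 mxE; case: eqP => _; rewrite ?normr1 ?normr0.
rewrite exprS -mulmxE mxE exprS.
apply: (le_trans (ler_norm_sum _ _ _)).
apply: (@le_trans _ _ (\sum_l `|X i l| * (\sum_i \sum_l `|X i l|) ^+ k)).
  by apply: ler_sum => l _; rewrite normrM ler_wpM2l.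
rewrite -mulr_suml ler_wpM2r//.
  by rewrite exprn_ge0//; apply: sumr_ge0 => ? _; apply: sumr_ge0.
rewrite [leRHS](bigD1 i)//= lerDl.
by apply: sumr_ge0 => ? _; apply: sumr_ge0.
Qed.

Lemma expr_scalemx t X k : (t *: X) ^+ k = t ^+ k *: X ^+ k.
Proof.
elim: k => [|k IHk]; first by rewrite !expr0 scale1r.
by rewrite !exprS IHk -!mulmxE -scalemxAl -scalemxAr scalerA.
Qed.

Lemma is_cvg_expmx_coef X i j m t : cvgn (pseries (expmx_coef X i j m) t).
Proof.
have [c c0 Xc] := entry_expr_le X.
apply: normed_cvg.
have cv : cvgn (series (c ^+ m *: exp_coeff (c * `|t|))).
  rewrite (_ : series _ = c ^+ m *: series (exp_coeff (c * `|t|))).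
    by apply: is_cvgZl_tmp; exact: is_cvg_series_exp_coeff.
  by apply/funext => N; exact/esym/scaler_sumr.
apply: series_le_cvg cv => [k|k|k] //=.
- by rewrite mulr_ge0 ?exprn_ge0 //= exp_coeff_ge0// mulr_ge0.
- rewrite /expmx_coef !normrM normrX normfV normr_nat /exp_coeff /=.
  rewrite [leRHS](_ : _ = k`!%:R^-1 * c ^+ (k + m) * `|t| ^+ k); last first.
    by rewrite fctE /= exprMn exprD /GRing.scale /=; ring.
  by rewrite ler_wpM2r ?exprn_ge0// ler_wpM2l ?invr_ge0.
Qed.

Lemma expmx_coef_diffs X i j m :
  pseries_diffs (expmx_coef X i j m) = expmx_coef X i j m.+1.
Proof.
apply/funext => k; rewrite /pseries_diffs /expmx_coef factS natrM invfM.
by rewrite mulrA mulVKf ?pnatr_eq0// addnS.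
Qed.

Lemma cvg_expmx X : series (fun k => (k`!%:R)^-1 *: X ^+ k) @ \oo --> expmx X.
Proof.
have [L XL] : exists L : 'M[R]_n,
    series (fun k => (k`!%:R)^-1 *: X ^+ k) @ \oo --> L; last first.
  by rewrite /expmx (cvg_lim _ XL)//; exact: norm_hausdorff.
exists (\matrix_(i, j) limn (pseries (expmx_coef X i j 0) 1)).
apply: cvg_mx => i j; rewrite mxE.
rewrite (_ : (fun _ => _) = pseries (expmx_coef X i j 0) 1).
  exact: is_cvg_expmx_coef.
apply/funext => N; rewrite /pseries /series /= summxE.
by apply: eq_bigr => k _; rewrite mxE /expmx_coef expr1n mulr1 addn0.
Qed.

Lemma cvg_expmx_entry X i j t :
  pseries (expmx_coef X i j 0) t @ \oo --> expmx (t *: X) i j.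
Proof.
have := cvg_comp _ _ (@cvg_expmx (t *: X)) (@coord_continuous _ _ _ i j _).
apply: cvg_trans; apply: near_eq_cvg; near=> N.
rewrite /pseries /series /= summxE; apply: eq_bigr => k _.
by rewrite mxE expr_scalemx mxE /expmx_coef addn0 mulrAC mulrA.
Unshelve. all: by end_near. Qed.

Lemma cvg_expmx_entry1 X i j t :
  pseries (expmx_coef X i j 1) t @ \oo --> (X *m expmx (t *: X)) i j.
Proof.
rewrite mxE.
rewrite (_ : pseries _ _ =
  (fun N => \sum_l X i l * pseries (expmx_coef X l j 0) t N)); last first.
  apply/funext => N; rewrite /pseries /series /=.
  under [RHS]eq_bigr do rewrite mulr_sumr.
  rewrite exchange_big /=; apply: eq_bigr => k _.
  rewrite /expmx_coef addn1 addn0 exprS -mulmxE mxE mulr_sumr mulr_suml.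
  by apply: eq_bigr => l _; ring.
apply: cvg_big => [|l _]; first exact: add_continuous.
apply: cvgMl_tmp; exact: cvg_expmx_entry.
Qed.

Lemma cvg_expmx_entry1r X i j t :
  pseries (expmx_coef X i j 1) t @ \oo --> (expmx (t *: X) *m X) i j.
Proof.
rewrite mxE.
rewrite (_ : pseries _ _ =
  (fun N => \sum_l pseries (expmx_coef X i l 0) t N * X l j)); last first.
  apply/funext => N; rewrite /pseries /series /=.
  under [RHS]eq_bigr do rewrite mulr_suml.
  rewrite exchange_big /=; apply: eq_bigr => k _.
  rewrite /expmx_coef addn1 addn0 exprSr -mulmxE mxE mulr_sumr mulr_suml.
  by apply: eq_bigr => l _; ring.
apply: cvg_big => [|l _]; first exact: add_continuous.
apply: cvgMr_tmp; exact: cvg_expmx_entry.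
Qed.

Lemma expmx_comm X t : X *m expmx (t *: X) = expmx (t *: X) *m X.
Proof.
apply/matrixP => i j.
rewrite -(cvg_lim (@Rhausdorff R) (@cvg_expmx_entry1 X i j t)).
exact/cvg_lim/cvg_expmx_entry1r.
Qed.

Lemma expmx_tr X : expmx X^T = (expmx X)^T.
Proof.
apply/matrixP => i j; rewrite mxE -[X in RHS]scale1r -[X^T]scale1r.
rewrite -(cvg_lim (@Rhausdorff R) (@cvg_expmx_entry X^T i j 1)).
rewrite (_ : expmx_coef _ _ _ _ = expmx_coef X j i 0).
  exact/cvg_lim/cvg_expmx_entry.
apply/funext => k; rewrite /expmx_coef; congr (_ * _).
rewrite addn0; rewrite (_ : X^T ^+ k = (X ^+ k)^T) ?mxE//.
elim: k => [|k IHk]; first by rewrite !expr0 trmx1.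
by rewrite exprS exprSr IHk -!mulmxE trmx_mul.
Qed.

Lemma expmx0 : expmx (0 : 'M[R]_n) = 1%:M.
Proof.
rewrite -(cvg_lim (@norm_hausdorff _ _) (@cvg_expmx 0)); apply: cvg_lim.
  exact: norm_hausdorff.
rewrite -cvg_shiftS (_ : [sequence _]_n = cst 1%:M); first exact: cvg_cst.
apply/funext => N; rewrite /series /= big_nat_recl// fact0 invr1 scale1r expr0.
rewrite big1 ?addr0// => k _.
by rewrite exprS mul0r scaler0.
Qed.

Lemma is_derive_expmx X t i j :
  is_derive t (1 : R) (fun x => expmx (x *: X) i j) ((X *m expmx (t *: X)) i j).
Proof.
rewrite (_ : (fun _ => _) = (fun x => limn (pseries (expmx_coef X i j 0) x))).
  rewrite -(cvg_lim _ (@cvg_expmx_entry1 X i j t))//.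
  rewrite -expmx_coef_diffs.
  (* any radius larger than |t| will do: the series converge everywhere *)
  apply: (@pseries_snd_diffs _ _ (`|t| + 1));
    rewrite ?expmx_coef_diffs; try exact: is_cvg_expmx_coef.
  by rewrite [ltRHS]ger0_norm// ltrDl.
apply/funext => x.
by rewrite (cvg_lim _ (@cvg_expmx_entry X i j x)).
Qed.

End EntrySeries.

Lemma is_derive_mulmx (R : realType) (m n p : nat) (A : R -> 'M[R]_(m, n))
    (B : R -> 'M[R]_(n, p)) (dA : 'M[R]_(m, n)) (dB : 'M[R]_(n, p)) (t : R) :
  (forall i j, is_derive t (1 : R) (fun x => A x i j) (dA i j)) ->
  (forall i j, is_derive t (1 : R) (fun x => B x i j) (dB i j)) ->
  forall i j, is_derive t (1 : R) (fun x => (A x *m B x) i j)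
    ((dA *m B t + A t *m dB) i j).
Proof.
move=> Ad Bd i j.
rewrite (_ : (fun _ => _) = \sum_l ((fun x => A x i l) * (fun x => B x l j)));
  last by apply/funext => x; rewrite mxE fct_sumE; apply: eq_bigr.
rewrite !mxE -big_split /=.
apply: is_derive_sum => l.
apply: is_derive_eq.
by rewrite /GRing.scale /=; ring.
Qed.

Lemma is_derive_cst_mx (R : realType) (m n : nat) (A : 'M[R]_(m, n)) (t : R)
    i j :
  is_derive t (1 : R) (fun=> A i j) ((0 : 'M[R]_(m, n)) i j).
Proof. by rewrite mxE; exact: is_derive_cst. Qed.

(** Derivative in x of u exp (x Y) G exp (x X) z.  With Y = X^T it describes how
    a bilinear form G varies along the flow of X, and with Y = - X and G = 1 it
    yields the inverse of exp X. *)
Lemma is_derive_expmx_sandwich (R : realType) (m n p q : nat) (Y : 'M[R]_m)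
    (X : 'M[R]_n) (u : 'M[R]_(p, m)) (G : 'M[R]_(m, n)) (z : 'M[R]_(n, q))
    t i j :
  is_derive t (1 : R)
    (fun x => (u *m expmx (x *: Y) *m G *m (expmx (x *: X) *m z)) i j)
    ((u *m expmx (t *: Y) *m (Y *m G + G *m X) *m (expmx (t *: X) *m z)) i j).
Proof.
have dY := is_derive_mulmx (is_derive_cst_mx u t) (is_derive_expmx Y t).
have dX := is_derive_mulmx (is_derive_expmx X t) (is_derive_cst_mx z t).
have dYG := is_derive_mulmx dY (is_derive_cst_mx G t).
have := is_derive_mulmx dYG dX i j.
congr (is_derive _ _ _ (fun_of_matrix _ _ _)).
rewrite mul0mx add0r !mulmx0 !addr0 expmx_comm mulmxDr mulmxDl.
by rewrite !mulmxA.
Qed.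

Section Exponential.
Variables (R : realType) (n : nat).
Implicit Types X : 'M[R]_n.

(** For Y = X^T: a bilinear form infinitesimally preserved by X is preserved by
    exp X. *)
Lemma expmx_sandwich_cst Y X (G : 'M[R]_n) : Y *m G + G *m X = 0 ->
  expmx Y *m G *m expmx X = G.
Proof.
move=> YX; apply/matrixP => i j.
pose f x := (1%:M *m expmx (x *: Y) *m G *m (expmx (x *: X) *m 1%:M)) i j.
have /(_ 1 0) : forall x y, f x = f y.
  move=> x y; apply: is_derive_0_is_cst => t.
  have := is_derive_expmx_sandwich Y X 1%:M G 1%:M t i j.
  by rewrite YX mulmx0 mul0mx mxE.
by rewrite /f !scale1r !scale0r !expmx0 !mulmx1 !mul1mx.
Qed.

Lemma expmxNl X : expmx (- X) *m expmx X = 1%:M.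
Proof.
rewrite -[RHS](@expmx_sandwich_cst (- X) X) ?mulmx1//.
by rewrite mul1mx addNr.
Qed.

Lemma expmx_unit X : expmx X \in unitmx.
Proof. by have /mulmx1_unit[] := expmxNl X. Qed.

Lemma invmx_expmx X : invmx (expmx X) = expmx (- X).
Proof.
by rewrite -[RHS]mulmx1 -(mulmxV (expmx_unit X)) mulmxA expmxNl mul1mx.
Qed.

(** If X^T K + K X is positive definite then the quadratic form of K strictly
    increases along the flow of X, by the mean value theorem. *)
Lemma expmx_form_lt X (K : 'M[R]_n) (z : 'cV[R]_n) :
  (forall v : 'cV[R]_n, v != 0 -> 0 < (v^T *m (X^T *m K + K *m X) *m v) 0 0) ->
  z != 0 ->
  (z^T *m K *m z) 0 0 < ((expmx X *m z)^T *m K *m (expmx X *m z)) 0 0.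
Proof.
move=> XK z0.
pose f x := (z^T *m expmx (x *: X^T) *m K *m (expmx (x *: X) *m z)) 0 0.
have df t := is_derive_expmx_sandwich X^T X z^T K z t 0 0.
have [|c _] := @MVT R f _ 0 1 ltr01 (fun t _ => df t).
  apply/continuous_subspaceT => t.
  exact/differentiable_continuous/derivable1_diffP.
rewrite /f !scale1r !scale0r !expmx0 mulmx1 mul1mx expmx_tr subr0 mulr1.
rewrite trmx_mul -subr_gt0 => ->.
rewrite -linearZ /= expmx_tr -trmx_mul; apply: XK.
apply: contra_neq z0 => /(congr1 (mulmx (expmx (- (c *: X))))).
by rewrite mulmxA expmxNl mul1mx mulmx0.
Qed.

End Exponential.

(** * Positive definite forms along Hamiltonian flows *)

Section PositiveDefinite.
Variables (R : realType) (n : nat).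
Implicit Types (X W : 'M[R]_n) (v : 'cV[R]_n).

Lemma sym_posdef_scale (c : R) X : 0 < c -> sym_posdef X -> sym_posdef (c *: X).
Proof.
move=> c0 [Xs Xp]; split=> [|v v0]; first by rewrite linearZ /= Xs.
by rewrite -scalemxAr -scalemxAl mxE mulr_gt0// Xp.
Qed.

Lemma sym_posdef_congr X W : W \in unitmx -> sym_posdef X ->
  sym_posdef (W^T *m X *m W).
Proof.
move=> Wu [Xs Xp]; split=> [|v v0].
  by rewrite !trmx_mul trmxK Xs mulmxA.
rewrite -!mulmxA mulmxA -trmx_mul mulmxA; apply: Xp.
apply: contra_neq v0 => /(congr1 (mulmx (invmx W))).
by rewrite mulmxA mulVmx// mul1mx mulmx0.
Qed.

Lemma cVdotE v : (v^T *m v) 0 0 = \sum_i v i 0 ^+ 2.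
Proof. by rewrite mxE; apply: eq_bigr => i _; rewrite mxE expr2. Qed.

Lemma cVdot_gt0 v : v != 0 -> 0 < (v^T *m v) 0 0.
Proof.
move=> v0; rewrite lt_neqAle eq_sym cVdotE sumr_ge0 ?andbT; last first.
  by move=> i _; exact: sqr_ge0.
apply: contra_neq v0 => /psumr_eq0P vi; apply/colP => i; rewrite mxE.
by apply/eqP; rewrite -sqrf_eq0 vi// => ? _; exact: sqr_ge0.
Qed.

Lemma sym_posdef_scalar (c : R) : 0 < c -> sym_posdef (c%:M : 'M[R]_n).
Proof.
move=> c0; rewrite -scalemx1; apply: sym_posdef_scale => //.
by split=> [|v v0]; rewrite ?trmx1// mulmx1 cVdot_gt0.
Qed.

End PositiveDefinite.

Section HamiltonianFlow.
Variables (R : realType) (n : nat).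
Implicit Types (a q s : 'M[R]_n) (z : 'M[R]_(n + n, n)).

(** For a state [V; W], the matrix V^T W; it is congruent to V W^-1 when W is
    invertible and V W^-1 is symmetric. *)
Definition state_form z : 'M[R]_n := (usubmx z)^T *m dsubmx z.

(** States from which the flow produces a positive definite form: the form is
    symmetric and positive semidefinite, and the 2n x n matrix [V; W] has full
    column rank. *)
Definition nonneg_state z : Prop :=
  [/\ (state_form z)^T = state_form z,
      forall v : 'cV[R]_n, 0 <= (v^T *m state_form z *m v) 0 0 &
      forall v : 'cV[R]_n, v != 0 -> z *m v != 0].

Lemma state_formE z : state_form z = z^T *m block_mx 0 1%:M 0 0 *m z.
Proof.
rewrite /state_form -[z in RHS]vsubmxK tr_col_mx mul_row_block mul_row_col.
by rewrite !mulmx0 !mulmx1 !addr0 mul0mx add0r.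
Qed.

(** The skew part of the form is the symplectic form. *)
Lemma state_form_skewE z :
  state_form z - (state_form z)^T = z^T *m block_mx 0 1%:M (- 1%:M) 0 *m z.
Proof.
rewrite /state_form -[z in RHS]vsubmxK tr_col_mx mul_row_block mul_row_col.
rewrite trmx_mul trmxK !mulmx0 mulmxN !mulmx1 !addr0 add0r mulNmx.
by rewrite addrC.
Qed.

Lemma nonneg_state_init : nonneg_state (col_mx 0 1%:M).
Proof.
rewrite /nonneg_state /state_form col_mxKu col_mxKd mulmx1 !trmx0.
split=> // v; first by rewrite mulmx0 mul0mx mxE.
apply: contra_neq => /eqP.
by rewrite mul_col_mx mul1mx -col_mx0 => /eqP/eq_col_mx[].
Qed.

Lemma posdef_nonneg_state z : sym_posdef (state_form z) -> nonneg_state z.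
Proof.
move=> [zs zp]; split=> // v.
  have [->|v0] := eqVneq v 0; first by rewrite mulmx0 mxE.
  exact/ltW/zp.
move=> v0; have := zp _ v0; apply: contraTneq => zv0.
rewrite state_formE mulmxA -mulmxA -[_ *m (z *m v)]mulmxA zv0.
by rewrite !mulmx0 mxE ltxx.
Qed.

Lemma posdef_stateP z : sym_posdef (state_form z) <->
  dsubmx z \in unitmx /\ sym_posdef (usubmx z *m invmx (dsubmx z)).
Proof.
rewrite /state_form; move: (usubmx z) (dsubmx z) => V W; split; last first.
  move=> [Wu Pp].
  rewrite (_ : V^T *m W = W^T *m (V *m invmx W) *m W).
    exact: sym_posdef_congr.
  by rewrite -{1}(mulmxKV Wu V) trmx_mul Pp.1.
move=> VW.
have Wu : W \in unitmx.
  rewrite -unitmx_tr -row_free_unit; apply/row_freeP.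
  suff : row_free W^T by move/row_freeP.
  rewrite -kermx_eq0; apply/rowV0P => u /sub_kermxP uW.
  apply/eqP; apply: contra_eqT (ltxx (0 : R)) => u0.
  rewrite -[X in _ < X](_ : (u^T^T *m (V^T *m W) *m u^T) 0 0 = 0).
    by rewrite VW.2// trmx_eq0.
  by rewrite -!mulmxA -(trmxK W) -trmx_mul uW trmx0 !mulmx0 mxE.
split=> //.
rewrite (_ : _ *m _ = (invmx W)^T *m (V^T *m W) *m invmx W).
  by apply: sym_posdef_congr; rewrite ?unitmx_inv.
rewrite -VW.1 trmx_mul trmxK mulmxA -trmx_mul mulmxV// trmx1 mul1mx.
by [].
Qed.

Lemma expmx_hamiltonian_posdef a q s z : sym_posdef q -> sym_posdef s ->
  nonneg_state z ->
  sym_posdef (state_form (expmx (block_mx a^T q s (- a)) *m z)).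
Proof.
move=> [qs qp] [ss sp] [zs zp zi]; set X := block_mx _ _ _ _.
have trX : X^T = block_mx a s q (- a^T).
  by rewrite /X tr_block_mx trmxK qs ss linearN.
split.
  apply/eqP; rewrite eq_sym -subr_eq0 state_form_skewE.
  rewrite (_ : _ *m _ *m _ = z^T *m
      (expmx X^T *m block_mx 0 1%:M (- 1%:M) 0 *m expmx X) *m z); last first.
    by rewrite expmx_tr trmx_mul !mulmxA.
  (* exp X is symplectic, so the skew part stays zero *)
  rewrite expmx_sandwich_cst; first by rewrite -state_form_skewE zs subrr.
  rewrite trX /X !mulmx_block !mulmx0 !mul0mx.
  rewrite !mulmxN !mulNmx !mulmx1 !mul1mx !addr0 !add0r add_block_mx.
  by rewrite opprK addNr !subrr block_mx0.
move=> v v0; rewrite state_formE.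
rewrite (_ : _ *m _ *m _ = (expmx X *m (z *m v))^T *m
    block_mx 0 1%:M 0 0 *m (expmx X *m (z *m v))); last first.
  by rewrite !trmx_mul !mulmxA.
(* the derivative of the form is V^T s V + W^T q W *)
apply: le_lt_trans (expmx_form_lt _ (zi v v0)).
  by have := zp v; rewrite state_formE trmx_mul !mulmxA.
move=> w w0; rewrite trX /X !mulmx_block !mulmx0 !mul0mx.
rewrite !mulmx1 !mul1mx !addr0 !add0r add_block_mx !addr0 add0r subrr.
rewrite -[w]vsubmxK tr_col_mx mul_row_block mul_row_col !mulmx0 addr0 add0r mxE.
have sp0 (u : 'cV[R]_n) : 0 <= (u^T *m s *m u) 0 0.
  have [->|u0] := eqVneq u 0; [by rewrite mulmx0 mxE | exact/ltW/sp].
have qp0 (u : 'cV[R]_n) : 0 <= (u^T *m q *m u) 0 0.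
  have [->|u0] := eqVneq u 0; [by rewrite mulmx0 mxE | exact/ltW/qp].
have [u0|u0] := eqVneq (usubmx w) 0; last by rewrite ltr_pwDl// sp.
rewrite ltr_wpDl//; apply: qp; apply: contra_neq w0 => d0.
by rewrite -[w]vsubmxK u0 d0 col_mx0.
Qed.

End HamiltonianFlow.

(** * Uniform positivity of Lipschitz coefficients *)

Section UniformPositivity.
Variables (R : realType) (n : nat).
Implicit Types (S : R -> 'M[R]_n) (u : 'rV[R]_n).

Lemma entry_le_norm (m p : nat) (X : 'M[R]_(m, p)) i j : `|X i j| <= `|X|.
Proof.
rewrite [leRHS]mx_normrE.
exact: (le_bigmax _ (fun ij : 'I_m * 'I_p => `|X ij.1 ij.2|) (i, j)).
Qed.

Lemma quad_le_norm (D : 'M[R]_n) u :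
  `|(u *m D *m u^T) 0 0| <= n%:R ^+ 2 * `|D| * `|u| ^+ 2.
Proof.
rewrite mxE (le_trans (ler_norm_sum _ _ _))//.
apply: (@le_trans _ _ (\sum_(j < n) (n%:R * (`|D| * `|u| ^+ 2)))); last first.
  by rewrite sumr_const card_ord -mulr_natl; lra.
apply: ler_sum => j _; rewrite !mxE normrM.
rewrite (_ : n%:R * _ = n%:R * (`|u| * `|D|) * `|u|); last by ring.
apply: ler_pM => //; last exact: entry_le_norm.
rewrite (le_trans (ler_norm_sum _ _ _))// mulr_natl.
rewrite -[X in _ *+ X]card_ord -sumr_const.
apply: ler_sum => i _; rewrite normrM.
by apply: ler_pM => //; exact: entry_le_norm.
Qed.

Lemma lipschitz_itvP S (t0 tf : R) : [lipschitz S t | t in `[t0, tf]] ->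
  exists2 L : R, 0 < L & forall x y, t0 <= x <= tf -> t0 <= y <= tf ->
    `|S x - S y| <= L * `|x - y|.
Proof.
move=> [M [_ MS]]; exists (`|M| + 1); first by rewrite ltr_wpDl.
move=> x y xI yI; apply: (MS (`|M| + 1) _ (x, y)) => /=.
  by rewrite (le_lt_trans (ler_norm M))// ltrDl.
by rewrite !in_itv.
Qed.

Lemma lipschitz_continuous (f : R -> R) (L : R) : 0 < L ->
  (forall x y, `|f x - f y| <= L * `|x - y|) -> continuous f.
Proof.
move=> L0 fL x; apply/cvgrPdist_le => e e0.
near=> y; apply: (le_trans (fL _ _)).
rewrite mulrC -ler_pdivlMr//; near: y.
have H : 0 < e / L by rewrite divr_gt0.
exact: (@cvgr_dist_le _ _ _ _ _ (fun y : R => y) x (@cvg_id _ (nbhs x)) _ H).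
Unshelve. all: by end_near. Qed.

(** The quadratic forms of the S t are bounded below by one positive multiple of
    the squared sup-norm, by compactness of [t0, tf] times the unit sphere. *)
Lemma lipschitz_posdef_bound S (t0 tf : R) : (0 < n)%N -> t0 <= tf ->
  [lipschitz S t | t in `[t0, tf]] ->
  (forall t, t0 <= t <= tf -> sym_posdef (S t)) ->
  exists2 m : R, 0 < m & forall t u, t0 <= t <= tf ->
    m * `|u| ^+ 2 <= (u *m S t *m u^T) 0 0.
Proof.
move=> n0 t0f /lipschitz_itvP[L L0 SL] Sp.
(* S is only controlled on [t0, tf]; precomposing with the retraction onto that
   interval makes it continuous on the whole line *)
pose clamp x := Num.max t0 (Num.min tf x).
have clampI x : t0 <= clamp x <= tf.
  by rewrite /clamp le_max lexx ge_max t0f ge_min lexx.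
have clampE x : t0 <= x <= tf -> clamp x = x.
  by move=> /andP[x0 xf]; rewrite /clamp min_r// max_r.
have clamp1 x y : `|clamp x - clamp y| <= `|x - y|.
  have xy := ler_norm (x - y); have := ler_norm (y - x).
  rewrite distrC; move: xy (normr_ge0 (x - y)); rewrite ler_norml /clamp.
  move: (`|x - y|) => d; rewrite /Num.max /Num.min => ? ? ?.
  by apply/andP; split; do !case: ifPn; rewrite -?leNgt => *; lra.
have Sc i j : continuous (fun x => S (clamp x) i j).
  apply: (lipschitz_continuous L0) => x y.
  apply: le_trans (_ : `|S (clamp x) - S (clamp y)| <= _).
    by have := entry_le_norm (S (clamp x) - S (clamp y)) i j; rewrite !mxE.
  by rewrite (le_trans (SL _ _ _ _))// ler_wpM2l// ltW.
pose g (p : R * 'rV[R]_n) := (p.2 *m S (clamp p.1) *m p.2^T) 0 0.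
have gc : continuous g.
  move=> p.
  have uc i : (fun p : R * 'rV[R]_n => p.2 0 i) @ p --> p.2 0 i.
    apply: (@continuous_comp _ _ _ snd (fun u : 'rV[R]_n => u 0 i)).
      exact: cvg_snd.
    exact: coord_continuous.
  have -> : g = fun p => \sum_j (\sum_i p.2 0 i * S (clamp p.1) i j) * p.2 0 j.
    by apply/funext => ?; rewrite /g mxE; apply: eq_bigr => j _; rewrite !mxE.
  apply: cvg_big => [|j _]; first exact: add_continuous.
  apply: cvgM; last exact: uc.
  apply: cvg_big => [|i _]; first exact: add_continuous.
  apply: cvgM; first exact: uc.
  apply: (@continuous_comp _ _ _ fst (fun x => S (clamp x) i j)).
    exact: cvg_fst.
  exact: Sc.
pose sphere := [set u : 'rV[R]_n | `|u| = 1].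
have sphere_cpt : compact sphere.
  apply: bounded_closed_compact.
    exists 1; split; first exact: real1.
    by move=> x x1 u /= ->; exact: ltW.
  have -> : sphere = (fun u : 'rV[R]_n => `|u|) @^-1` [set 1] by [].
  by apply: closed_comp => [u _|]; [exact: norm_continuous|exact: closed_eq].
have normalize u : u != 0 -> sphere (`|u|^-1 *: u).
  move=> u0; rewrite /sphere /= normrZ normfV normr_id mulVf//.
  by rewrite normr_eq0.
pose K := `[t0, tf] `*` sphere.
have K0 : K !=set0.
  exists (t0, `|const_mx 1 : 'rV[R]_n|^-1 *: const_mx 1); split=> /=.
    by rewrite in_itv /= lexx t0f.
  apply: normalize; apply/eqP => /rowP/(_ (Ordinal n0)).
  by rewrite !mxE => /eqP; rewrite oner_eq0.
have [[c w] /set_mem[/= cI w1] gmin] :=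
  compact_EVT_min K0 (compact_setX (@segment_compact R t0 tf) sphere_cpt)
    (continuous_subspaceT gc).
exists (g (c, w)).
  have := (Sp _ (clampI c)).2 w^T; rewrite trmxK; apply.
  rewrite trmx_eq0; apply: contra_eq_neq w1 => ->.
  by rewrite normr0 eq_sym oner_eq0.
move=> t u tI; have [->|u0] := eqVneq u 0.
  by rewrite normr0 expr0n mulr0 !mul0mx mxE.
have uN : 0 < `|u| by rewrite normr_gt0.
have := gmin (t, `|u|^-1 *: u).
rewrite {2}/g /= clampE// linearZ /= -scalemxAr -!scalemxAl !mxE.
rewrite mulrA -invfM -expr2 mulrC ler_pdivlMr ?exprn_gt0//; apply.
by apply/mem_set; split; rewrite /= ?in_itv//; exact: normalize.
Qed.

(** A combination of two values of S at nearby times is positive definite as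
    soon as the sum of its coefficients is positive, whatever their signs. *)
Lemma lipschitz_posdef_comb S (t0 tf a b : R) : (0 < n)%N -> t0 <= tf ->
  [lipschitz S t | t in `[t0, tf]] ->
  (forall t, t0 <= t <= tf -> sym_posdef (S t)) -> 0 < a + b ->
  exists2 d : R, 0 < d & forall x y, t0 <= x <= tf -> t0 <= y <= tf ->
    `|x - y| < d -> sym_posdef (a *: S x + b *: S y).
Proof.
move=> n0 t0f SL Sp ab.
have [m m0 mS] := lipschitz_posdef_bound n0 t0f SL Sp.
have [L L0 {}SL] := lipschitz_itvP SL.
have N0 : 0 < n%:R :> R by rewrite ltr0n.
pose C := (`|b| + 1) * n%:R ^+ 2 * L.
have C0 : 0 < C by rewrite !mulr_gt0 ?exprn_gt0// ltr_wpDl.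
exists ((a + b) * m / C); first by rewrite !mulr_gt0 ?invr_gt0.
move=> x y xI yI; rewrite ltr_pdivlMr// => xy.
split=> [|v v0]; first by rewrite linearD !linearZ /= (Sp _ xI).1 (Sp _ yI).1.
have u0 : 0 < `|v^T| by rewrite normr_gt0 trmx_eq0.
(* a S x + b S y = (a + b) S x + b (S y - S x) *)
rewrite (_ : (v^T *m _ *m v) 0 0 =
  (a + b) * (v^T *m S x *m v) 0 0 + b * (v^T *m (S y - S x) *m v) 0 0);
  last first.
  rewrite mulmxBr mulmxDr !mulmxBl mulmxDl -!scalemxAr -!scalemxAl !mxE.
  by ring.
have := mS x v^T xI; rewrite trmxK => mx.
have := quad_le_norm (S y - S x) v^T; rewrite trmxK => qd.
have {}SL := SL _ _ yI xI; rewrite distrC in xy.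
set q := (v^T *m (S y - S x) *m v) 0 0 in qd *.
have u2 : 0 < `|v^T| ^+ 2 by rewrite exprn_gt0.
have bq : - (b * q) <= (`|b| + 1) * (n%:R ^+ 2 * (L * `|y - x|) * `|v^T| ^+ 2).
  rewrite (le_trans (ler_norm _))// normrN normrM ler_pM// ?lerDl//.
  rewrite (le_trans qd)// ler_wpM2r ?exprn_ge0// ler_wpM2l// exprn_ge0//.
have aq : (a + b) * (m * `|v^T| ^+ 2) <= (a + b) * (v^T *m S x *m v) 0 0.
  by rewrite ler_wpM2l// ltW.
have : `|y - x| * C * `|v^T| ^+ 2 < (a + b) * m * `|v^T| ^+ 2.
  by rewrite ltr_pM2r.
rewrite /C; lra.
Qed.

End UniformPositivity.

(** * Conditional positivity of the Gauss integrator *)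

Section OneStep.
Variables (R : realType) (n : nat).
Implicit Types (A S Q : R -> 'M[R]_n) (z : 'M[R]_(n + n, n)).

Lemma invmx_expmx_mul (X Y : 'M[R]_(n + n)) :
  invmx (expmx X *m expmx Y) = expmx (- Y) *m expmx (- X).
Proof.
have XY : expmx X *m expmx Y \in unitmx by rewrite unitmx_mul !expmx_unit.
apply: (can_inj (mulKmx XY)); rewrite mulmxV//.
rewrite mulmxA -[_ *m _ *m expmx (- Y)]mulmxA -!invmx_expmx.
by rewrite mulmxV ?expmx_unit// mulmx1 mulmxV ?expmx_unit.
Qed.

Lemma opp_riccati_mx_comb A S Q (h a b x y : R) :
  - (h *: (a *: riccati_mx A S Q x + b *: riccati_mx A S Q y)) =
  block_mx (h *: (a *: A x + b *: A y))^T (h *: (a *: Q x + b *: Q y))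
    (h *: (a *: S x + b *: S y)) (- (h *: (a *: A x + b *: A y))).
Proof.
rewrite /riccati_mx !scale_block_mx add_block_mx scale_block_mx opp_block_mx.
by congr block_mx; apply/matrixP => i j; rewrite !mxE; ring.
Qed.

Lemma backward_state_posdef (Psi : integrator R n) M (t0 h : R) (N : nat) :
  (forall j z, (j < N)%N -> nonneg_state z ->
    sym_posdef (state_form (invmx (Psi M h (t0 + j%:R * h)) *m z))) ->
  forall k, (0 < k <= N)%N ->
    sym_posdef (state_form (backward_state Psi M t0 h N k)).
Proof.
move=> step; elim=> [//|k IHk] /andP[_ kN] /=.
apply: step; first by rewrite ltn_subrL (leq_trans _ kN).
case: k IHk kN => [|k] IHk kN; first exact: nonneg_state_init.
by apply/posdef_nonneg_state/IHk; exact: ltnW.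
Qed.

Lemma cfm_gauss_conditional (t0 tf : R) : (0 < n)%N -> t0 < tf ->
  conditionally_positivity_preserving (cfm_gauss R n) t0 tf.
Proof.
move=> n0 t0f A S Q [_ SL QL Sp Qp].
pose r : R := Num.sqrt 3; pose al : R := 1 / 4 - r / 6.
pose be : R := 1 / 4 + r / 6.
have r0 : 0 <= r by exact: sqrtr_ge0.
have r2 : r < 3.
  by rewrite -(ltr_pXn2r (isT : 0 < 2)%N) ?nnegrE// sqr_sqrtr//; lra.
have ab : 0 < al + be by rewrite /al /be; lra.
have ba : 0 < be + al by rewrite addrC.
have [d1 d1_0 P1] := lipschitz_posdef_comb n0 (ltW t0f) SL Sp ab.
have [d2 d2_0 P2] := lipschitz_posdef_comb n0 (ltW t0f) SL Sp ba.
have [d3 d3_0 P3] := lipschitz_posdef_comb n0 (ltW t0f) QL Qp ab.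
have [d4 d4_0 P4] := lipschitz_posdef_comb n0 (ltW t0f) QL Qp ba.
exists (Num.min (Num.min d1 d2) (Num.min d3 d4)).
  by rewrite !lt_min d1_0 d2_0 d3_0.
move=> N N0 /andP[h0]; rewrite !lt_min => /andP[/andP[h1 h2] /andP[h3 h4]].
move=> j jN; apply/posdef_stateP.
apply: backward_state_posdef; last by rewrite subn_gt0 jN leq_subr.
move=> {jN}{}j z jN z0; set h := step_size t0 tf N in h0 h1 h2 h3 h4 *.
have Nh : N%:R * h = tf - t0.
  by rewrite mulrC divfK// pnatr_eq0 -lt0n.
have jh : 0 <= j%:R * h by rewrite mulr_ge0// ltW.
have jh1 : j%:R * h + h <= tf - t0.
  rewrite -Nh (_ : _ + h = j.+1%:R * h); last by rewrite -natr1 mulrDl mul1r.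
  by rewrite ler_wpM2r ?ler_nat// ltW.
set t := t0 + j%:R * h.
set x := t + (1 / 2 - r / 6) * h; set y := t + (1 / 2 + r / 6) * h.
have xI : t0 <= x <= tf by rewrite /x /t; apply/andP; split; nra.
have yI : t0 <= y <= tf by rewrite /y /t; apply/andP; split; nra.
have xy : `|x - y| <= h.
  rewrite (_ : x - y = - (r / 3 * h)) ?normrN; last by rewrite /x /y; lra.
  by rewrite ger0_norm; nra.
rewrite /cfm_gauss -/r -/al -/be -/x -/y.
rewrite invmx_expmx_mul !opp_riccati_mx_comb -mulmxA.
have pd T d a b : (forall x y, t0 <= x <= tf -> t0 <= y <= tf ->
    `|x - y| < d -> sym_posdef (a *: T x + b *: T y)) -> h < d ->
    sym_posdef (h *: (a *: T x + b *: T y) : 'M[R]_n).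
  by move=> Td hd; apply: sym_posdef_scale => //; apply/Td/(le_lt_trans xy).
apply: expmx_hamiltonian_posdef; [exact: pd P4 h4|exact: pd P2 h2|].
apply/posdef_nonneg_state/expmx_hamiltonian_posdef => //.
  exact: pd P3 h3.
exact: pd P1 h1.
Qed.

End OneStep.

(** * Failure of positivity for large steps *)

Section Rotation.
Variables (R : realType).

(** Euler's formula for a complex structure J.  The right-hand side solves the
    same linear equation as the exponential, so exp (- x J) times it is
    constant. *)
Lemma expmx_rotation (n : nat) (J : 'M[R]_n) (x : R) : J *m J = - 1%:M ->
  expmx (x *: J) = cos x *: 1%:M + sin x *: J.
Proof.
move=> JJ; pose rot x := cos x *: 1%:M + sin x *: J.
suff rotE : expmx (- (x *: J)) *m rot x = 1%:M.
  have := congr1 (mulmx (expmx (x *: J))) rotE.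
  by rewrite mulmxA -invmx_expmx mulmxV ?expmx_unit// mul1mx mulmx1 => <-.
apply/matrixP => i j; pose f y := (expmx (y *: - J) *m rot y) i j.
have /(_ x 0) : forall y y', f y = f y'.
  move=> y y'; apply: is_derive_0_is_cst => {}y {y'}.
  have drot k l : is_derive y (1 : R) (fun y => rot y k l)
      ((- sin y *: 1%:M + cos y *: J) k l).
    rewrite (_ : (fun _ => _) = (fun y => cos y * (1%:M : 'M[R]_n) k l) +
        (fun y => sin y * J k l)); last by apply/funext => ?; rewrite !mxE.
    apply: is_derive_eq.
    by rewrite !mxE /GRing.scale /=; ring.
  have := is_derive_mulmx (is_derive_expmx (- J) y) drot i j.
  congr (is_derive _ _ _ _).
  rewrite expmx_comm -mulmxA -mulmxDr [X in _ *m X](_ : _ = 0) ?mulmx0 ?mxE//.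
  rewrite /rot mulNmx mulmxDr -!scalemxAr JJ mulmx1.
  by apply/matrixP => k l; rewrite !mxE; ring.
rewrite /f scale0r expmx0 /rot cos0 sin0 scale1r scale0r addr0 mulmx1.
by rewrite scalerN.
Qed.

Lemma state_form_quarter_turn (n : nat) (z : 'M[R]_(n + n, n)) :
  state_form (expmx ((pi / 2) *: block_mx 0 1%:M (- 1%:M) 0) *m z) =
  - (state_form z)^T.
Proof.
rewrite expmx_rotation; last first.
  rewrite mulmx_block !mulmx0 !mul0mx !mulmxN !mulmx1 !addr0 !add0r.
  by rewrite scalar_mx_block opp_block_mx oppr0.
rewrite cos_pihalf sin_pihalf scale0r add0r scale1r -[z in LHS]vsubmxK.
rewrite mul_block_col /state_form col_mxKu col_mxKd.
by rewrite !mul0mx mulNmx !mul1mx addr0 add0r mulmxN trmx_mul trmxK.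
Qed.

End Rotation.

Section Counterexample.
Variables (R : realType) (n : nat).
Implicit Types (Psi : integrator R n).

(** Data for which a single step of size h = tf - t0 produces an oscillation.
    With u = (t - t0) / h, the polynomial 144 u^2 - 48 u + 6 equals
    144 (u - 1/6)^2 + 2, hence is positive.  The two combinations formed by
    either integrator, with their respective weights of total 1/2, take the
    values 31 and -1 on it, and the value pi / (2 h) on the constant pi / h. *)
Definition oscA (t : R) : 'M[R]_n := 0.

Definition oscQ (h t : R) : 'M[R]_n := (pi / h)%:M.

Definition oscS (t0 h t : R) : 'M[R]_n :=
  let u := (t - t0) / h in
  (pi / (2 * h) * (144 * u ^+ 2 - 48 * u + 6))%:M.

Lemma lipschitz_itvI (S : R -> 'M[R]_n) (t0 tf k : R) :
  (forall x y, t0 <= x <= tf -> t0 <= y <= tf ->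
    `|S x - S y| <= k * `|x - y|) -> [lipschitz S t | t in `[t0, tf]].
Proof.
move=> Sk; exists k; split=> [|M kM [x y] /= []]; first exact: num_real.
rewrite !in_itv /= => xI yI.
by rewrite (le_trans (Sk _ _ xI yI))// ler_wpM2r// ltW.
Qed.

Lemma osc_data (t0 tf : R) : t0 < tf ->
  riccati_data t0 tf oscA (oscS t0 (tf - t0)) (oscQ (tf - t0)).
Proof.
move=> t0f; set h := tf - t0; have h0 : 0 < h by rewrite subr_gt0.
have hN : h != 0 by rewrite gt_eqF.
have p0 := pi_gt0 R.
split.
- exact/continuous_subspaceT/cst_continuous.
- have [c cE c0] : exists2 c : R, pi / (2 * h) = c & 0 < c.
    by exists (pi / (2 * h)); rewrite ?divr_gt0// mulr_gt0.
  apply: (@lipschitz_itvI _ _ _ (c * 240 / h)) => x y /andP[x0 xf] /andP[y0 yf].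
  rewrite /oscS cE; set u := (x - t0) / h; set v := (y - t0) / h.
  rewrite -raddfB /=.
  have uv : u - v = (x - y) / h by rewrite /u /v -mulrBl; congr (_ / _); ring.
  have itv w : t0 <= w -> w <= tf -> 0 <= (w - t0) / h <= 1.
    move=> w0 wf; apply/andP; split.
      by rewrite divr_ge0 ?subr_ge0// ltW.
    by rewrite ler_pdivrMr// mul1r lerD2r.
  have u01 : 0 <= u <= 1 by exact: itv.
  have v01 : 0 <= v <= 1 by exact: itv.
  rewrite (_ : _ - _ = c * (144 * (u + v) - 48) / h * (x - y)); last first.
    by rewrite [RHS]mulrAC -[RHS]mulrA -uv; ring.
  apply: (@le_trans _ _ `|c * (144 * (u + v) - 48) / h * (x - y)|).
    rewrite [leLHS]mx_normrE; apply/bigmax_leP; split => //= -[i j] _ /=.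
    by rewrite mxE; case: eqP => _; rewrite ?mulr1n// mulr0n normr0.
  rewrite normrM ler_wpM2r// !normrM (gtr0_norm c0) normfV (gtr0_norm h0).
  rewrite ler_wpM2r ?invr_ge0 ?(ltW h0)// ler_wpM2l ?(ltW c0)//.
  by rewrite ler_norml; apply/andP; split; lra.
- apply: (@lipschitz_itvI _ _ _ 0) => x y _ _.
  by rewrite /oscQ subrr normr0 mul0r.
- move=> t _; apply: sym_posdef_scalar; rewrite mulr_gt0 ?divr_gt0 ?mulr_gt0//.
  by move: ((t - t0) / h) => u; have := sqr_ge0 (12 * u - 2); nra.
- by move=> t _; apply: sym_posdef_scalar; rewrite divr_gt0.
Qed.

(** An integrator whose backward step on the oscillating data is a quarter turn
    after the flow of a positive definite Hamiltonian loses positivity. *)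
Lemma not_unconditional Psi (t0 tf : R) : (0 < n)%N -> t0 < tf ->
  let M := riccati_mx oscA (oscS t0 (tf - t0)) (oscQ (tf - t0)) in
  invmx (Psi M (tf - t0) t0) =
    expmx ((pi / 2) *: block_mx 0 1%:M (- 1%:M) 0) *m
    expmx (block_mx 0 (pi / 2)%:M (31 * (pi / 2))%:M 0) ->
  ~ unconditionally_positivity_preserving Psi t0 tf.
Proof.
move=> n0 t0f M PsiE /(_ _ _ _ (osc_data t0f) 1%N isT 0%N isT).
move=> /posdef_stateP; rewrite /step_size divr1 -/M /= mul0r addr0 PsiE.
rewrite -mulmxA state_form_quarter_turn.
have pi2 : 0 < pi / 2 :> R by rewrite divr_gt0// pi_gt0.
have := @expmx_hamiltonian_posdef R n 0 _ _ _ (sym_posdef_scalar n pi2)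
  (sym_posdef_scalar n (mulr_gt0 (ltr0Sn _ 30) pi2)) (nonneg_state_init R n).
rewrite trmx0 oppr0; set F := state_form _ => -[Fs Fp] [_ Fn].
have v0 : const_mx 1 != 0 :> 'cV[R]_n.
  apply/eqP => /colP/(_ (Ordinal n0)).
  by rewrite !mxE => /eqP; rewrite oner_eq0.
have := Fp _ v0; have := Fn _ v0.
by rewrite Fs mulmxN mulNmx mxE oppr_gt0 => /lt_trans /[apply]; rewrite ltxx.
Qed.

(** The matrix [0, p; s, 0] with scalar blocks; on the oscillating data all
    exponents have this form. *)
Definition offdiag (p s : R) : 'M[R]_(n + n) := block_mx 0 p%:M s%:M 0.

Lemma scale_offdiag (a p s : R) : a *: offdiag p s = offdiag (a * p) (a * s).
Proof. by rewrite /offdiag scale_block_mx !scaler0 !scale_scalar_mx. Qed.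

Lemma scale_symplectic (a : R) :
  a *: block_mx 0 1%:M (- 1%:M) 0 = offdiag a (- a).
Proof.
by rewrite /offdiag scale_block_mx !scaler0 scalerN scalemx1 -raddfN.
Qed.

Lemma opp_offdiag (p s : R) : - offdiag p s = offdiag (- p) (- s).
Proof. by rewrite -scaleN1r scale_offdiag !mulN1r. Qed.

Lemma add_offdiag (p s p' s' : R) :
  offdiag p s + offdiag p' s' = offdiag (p + p') (s + s').
Proof. by rewrite /offdiag add_block_mx !addr0 -!raddfD. Qed.

Lemma osc_riccati_mx (t0 h u : R) : h != 0 ->
  riccati_mx oscA (oscS t0 h) (oscQ h) (t0 + u * h) =
  offdiag (- (pi / h)) (- (pi / (2 * h) * (144 * u ^+ 2 - 48 * u + 6))).
Proof.
move=> h0; rewrite /riccati_mx /oscA /oscS /oscQ trmx0 oppr0 /offdiag.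
by rewrite [t0 + _]addrC addrK mulfK// -!raddfN.
Qed.

Lemma cfm_gauss_not_unconditional (t0 tf : R) : (0 < n)%N -> t0 < tf ->
  ~ unconditionally_positivity_preserving (cfm_gauss R n) t0 tf.
Proof.
move=> n0 t0f; apply: not_unconditional => //.
set h := tf - t0; have h0 : h != 0 by rewrite subr_eq0 gt_eqF.
rewrite /cfm_gauss invmx_expmx_mul !osc_riccati_mx//.
have r2 : Num.sqrt 3 ^+ 2 = 3 :> R by rewrite sqr_sqrtr.
move: (Num.sqrt 3) r2 => r r2.
have r3 : r ^+ 3 = 3 * r by rewrite exprS r2 mulrC.
rewrite !(scale_offdiag, add_offdiag, opp_offdiag).
congr (expmx _ *m expmx _).
  rewrite scale_symplectic; congr offdiag; first by field.
  transitivity (pi / 2 *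
    ((1 / 4 + r / 6) * (144 * (1 / 2 - r / 6) ^+ 2 - 48 * (1 / 2 - r / 6) + 6) +
     (1 / 4 - r / 6) * (144 * (1 / 2 + r / 6) ^+ 2 - 48 * (1 / 2 + r / 6) + 6))).
    by field.
  (* polynomial identity in r, using r^2 = 3 and r^3 = 3 r *)
  by rewrite -[RHS]mulrN1; congr (_ * _); lra.
rewrite -/(offdiag _ _); congr offdiag; first by field.
transitivity (pi / 2 *
    ((1 / 4 - r / 6) * (144 * (1 / 2 - r / 6) ^+ 2 - 48 * (1 / 2 - r / 6) + 6) +
     (1 / 4 + r / 6) * (144 * (1 / 2 + r / 6) ^+ 2 - 48 * (1 / 2 + r / 6) + 6))).
  by field.
by rewrite mulrC; congr (_ * _); lra.
Qed.

Lemma cfm_simpson_not_unconditional (t0 tf : R) : (0 < n)%N -> t0 < tf ->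
  ~ unconditionally_positivity_preserving (cfm_simpson R n) t0 tf.
Proof.
move=> n0 t0f; apply: not_unconditional => //.
set h := tf - t0; have h0 : h != 0 by rewrite subr_eq0 gt_eqF.
have M1 := osc_riccati_mx t0 0 h0; rewrite mul0r addr0 in M1.
have M2 := osc_riccati_mx t0 2^-1 h0; rewrite (mulrC 2^-1) in M2.
have M3 := osc_riccati_mx t0 1 h0; rewrite mul1r in M3.
rewrite /cfm_simpson invmx_expmx_mul M1 M2 M3.
rewrite !(scale_offdiag, add_offdiag, opp_offdiag).
congr (expmx _ *m expmx _).
  by rewrite scale_symplectic; congr offdiag; field.
by rewrite -/(offdiag _ _); congr offdiag; field.
Qed.

End Counterexample.

Theorem mainTheorem3 (R : realType) (n : nat) (t0 tf : R)
    (hn : (0 < n)%N) (ht : t0 < tf) :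
  (conditionally_positivity_preserving (cfm_gauss R n) t0 tf /\
   ~ unconditionally_positivity_preserving (cfm_gauss R n) t0 tf) /\
  ~ unconditionally_positivity_preserving (cfm_simpson R n) t0 tf.
Proof.
split; last exact: cfm_simpson_not_unconditional.
split; first exact: cfm_gauss_conditional.
exact: cfm_gauss_not_unconditional.
Qed.
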